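(* Let $(\mathcal{G},\mathcal{P})$ and $(\mathcal{F},\mathcal{Q})$ be Banach $\widetilde{\mathbb{C}}$-modules. Let $Y\subseteq\mathcal{L}(\mathcal{G},\mathcal{F})$ be pointwise bounded, i.e. $\sup_{T\in Y}\mathcal{Q}(Tu)<\infty$ for all $u\in\mathcal{G}$. Then $Y$ is a bounded subset of the $\widetilde{\mathbb{C}}$-module $(\mathcal{L}(\mathcal{G},\mathcal{F}),\mathcal{P}_{\mathcal{L}(\mathcal{G},\mathcal{F})})$, i.e. $\sup_{T\in Y}\mathcal{P}_{\mathcal{L}(\mathcal{G},\mathcal{F})}(T)<\infty$.
   Context: Generalized numbers: $\widetilde{\mathbb{C}}=\mathcal{E}_M/\mathcal{N}$, where $\mathcal{E}_M$ is the ring of nets $(c_\varepsilon)_\varepsilon\in\mathbb{C}^{(0,1]}$ with $|c_\varepsilon|=O(\varepsilon^{-N})$ as $\varepsilon\to0$ for some $N\in\mathbb{N}$, and $\mathcal{N}$ is the ideal of nets with $|c_\varepsilon|=O(\varepsilon^{q})$ for all $q\in\mathbb{N}$; $[(c_\varepsilon)_\varepsilon]$ denotes the class of $(c_\varepsilon)_\varepsilon$. The valuation is $\mathrm{v}(c)=\sup\{b\in\mathbb{R}: |c_\varepsilon|=O(\varepsilon^b)\text{ as }\varepsilon\to0\}$ and $|c|_{\mathrm e}=e^{-\mathrm{v}(c)}$. An ultra-pseudo-norm on a $\widetilde{\mathbb{C}}$-module $\mathcal{G}$ is a map $\mathcal{P}:\mathcal{G}\to[0,\infty)$ such that: $\mathcal{P}(u)=0$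 if and only if $u=0$; $\mathcal{P}(\lambda u)\le|\lambda|_{\mathrm e}\mathcal{P}(u)$ for all $\lambda\in\widetilde{\mathbb{C}}$; $\mathcal{P}([(c\,\varepsilon^a)_\varepsilon]u)=e^{-a}\mathcal{P}(u)$ for all $c\in\mathbb{C}\setminus\{0\}$, $a\in\mathbb{R}$; and $\mathcal{P}(u+v)\le\max\{\mathcal{P}(u),\mathcal{P}(v)\}$. $(\mathcal{G},\mathcal{P})$ is a Banach $\widetilde{\mathbb{C}}$-module if $\mathcal{G}$ is complete for the metric $\mathcal{P}(u-v)$. $\mathcal{L}(\mathcal{G},\mathcal{F})$ is the $\widetilde{\mathbb{C}}$-module of continuous $\widetilde{\mathbb{C}}$-linear maps $\mathcal{G}\to\mathcal{F}$, with the ultra-pseudo-norm $\mathcal{P}_{\mathcal{L}(\mathcal{G},\mathcal{F})}(T)=\sup_{\mathcal{P}(u)=1}\mathcal{Q}(Tu)$. *)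

(* Defs.v *)
From HB Require Import structures.
From mathcomp Require Import all_boot all_order all_algebra.
From mathcomp Require Import all_classical all_reals all_analysis.
From mathcomp Require Import complex ring lra.

Set Implicit Arguments.
Unset Strict Implicit.
Unset Printing Implicit Defensive.

Import Order.TTheory GRing.Theory Num.Def Num.Theory.
Import numFieldNormedType.Exports.
Import ComplexField.Normc.
Local Open Scope classical_set_scope.
Local Open Scope ring_scope.

Section nets.
Variable R : realType.

Definition eps01 := {e : R | 0 < e <= 1}.
HB.instance Definition _ := Choice.on eps01.

Lemma eps01_gt0 (e : eps01) : 0 < val e. Proof. by case/andP: (valP e). Qed.
Lemma eps01_le1 (e : eps01) : val e <= 1. Proof. by case/andP: (valP e). Qed.

Definition eps01_one : eps01 := exist _ 1 (introT andP (conj ltr01 (lexx 1))).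
HB.instance Definition _ := isPointed.Build eps01 eps01_one.

(* the filter of neighbourhoods of 0 in ]0, 1] *)
Definition eps_to0 : set_system eps01 :=
  filter_from [set d : R | 0 < d] (fun d => [set e | val e < d]).

#[global] Instance eps_to0_filter : ProperFilter eps_to0.
Proof.
apply: filter_from_proper.
  apply: filter_from_filter; first by exists 1; exact: ltr01.
  move=> i j i0 j0; exists (minr i j); first by rewrite /= lt_min i0.
  by move=> e /=; rewrite lt_min => /andP[].
move=> d /= d0.
have h : 0 < minr 1 (d / 2) <= 1.
  by rewrite lt_min ltr01 divr_gt0//= ge_min lexx.
exists (Sub (minr 1 (d / 2)) h : eps01) => /=.
by rewrite gt_min ltr_pdivrMr// ltr_pMr// ltr1n orbT.
Qed.

Canonical eps_to0_filter_on := FilterType eps_to0 eps_to0_filter.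

Definition net := eps01 -> R[i].
HB.instance Definition _ := GRing.ComNzRing.on net.

Definition net_bigO (c : net) (b : R) : Prop :=
  (fun e => normc (c e) : R^o) =O_eps_to0 (fun e => val e `^ b : R^o).

Lemma net_bigOP (c : net) (b : R) : net_bigO c b <->
  exists2 k : R, 0 < k & \forall e \near eps_to0, normc (c e) <= k * val e `^ b.
Proof.
have n0 z : 0 <= normc z :> R by case: z => x y; exact: sqrtr_ge0.
rewrite /net_bigO; split => [/eqO_exP|] [k k0 H].
  exists k => //; near=> e.
  have : `|normc (c e) : R^o| <= k * `|val e `^ b : R^o| by near: e.
  by rewrite !ger0_norm ?powR_ge0.
apply/eqO_exP; exists k => //; near=> e.
rewrite !ger0_norm ?powR_ge0//.
by near: e.
Unshelve. all: by end_near.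
Qed.

Lemma net_bigO_le (c : net) (b b' : R) : b <= b' -> net_bigO c b' -> net_bigO c b.
Proof.
move=> bb' /net_bigOP[k k0 H]; apply/net_bigOP; exists k => //.
near=> e; apply: (@le_trans _ _ (k * val e `^ b')); first by near: e.
rewrite ler_pM2l//; apply: ger_powR => //; exact: (valP e).
Unshelve. all: by end_near.
Qed.

Lemma net_bigO0 b : net_bigO 0 b.
Proof.
apply/net_bigOP; exists 1 => //; near=> e.
by rewrite [X in normc X](_ : _ = 0)// normc0 mul1r powR_ge0.
Unshelve. all: by end_near.
Qed.

Lemma net_bigOD (c d : net) b : net_bigO c b -> net_bigO d b -> net_bigO (c + d) b.
Proof.
move=> /net_bigOP[k k0 H] /net_bigOP[l l0 K]; apply/net_bigOP.
exists (k + l); first exact: addr_gt0.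
near=> e; rewrite mulrDl.
apply: (le_trans (le_normcD _ _)); apply: lerD; by near: e.
Unshelve. all: by end_near.
Qed.

Lemma net_bigON (c : net) b : net_bigO c b -> net_bigO (- c) b.
Proof.
move=> /net_bigOP[k k0 H]; apply/net_bigOP; exists k => //.
by near=> e; rewrite [normc _]normcN; near: e.
Unshelve. all: by end_near.
Qed.

Lemma net_bigOM (c d : net) a b :
  net_bigO c a -> net_bigO d b -> net_bigO (c * d) (a + b).
Proof.
move=> /net_bigOP[k k0 H] /net_bigOP[l l0 K]; apply/net_bigOP.
exists (k * l); first exact: mulr_gt0.
near=> e; rewrite [normc _]normcM powRD; last first.
  by rewrite (gt_eqF (eps01_gt0 e)) implybT.
rewrite mulrACA; apply: ler_pM; last 2 first.
- by near: e.
- by near: e.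
- by case: (c e) => x y; exact: sqrtr_ge0.
- by case: (d e) => x y; exact: sqrtr_ge0.
Unshelve. all: by end_near.
Qed.

(* the net (z e^a)_e *)
Definition pow_net (z : R[i]) (a : R) : net := fun e => z * (val e `^ a)%:C%C.

Lemma pow_net_bigO z a : net_bigO (pow_net z a) a.
Proof.
apply/net_bigOP; exists (normc z + 1).
  by rewrite ltr_wpDl//; case: z => x y; exact: sqrtr_ge0.
near=> e; rewrite /pow_net normcM /= expr0n addr0 sqrtr_sqr ger0_norm ?powR_ge0//.
by rewrite ler_wpM2r ?powR_ge0// lerDl.
Unshelve. all: by end_near.
Qed.

Lemma net1_bigO : net_bigO 1 0.
Proof.
have -> : (1 : net) = pow_net 1 0; last exact: pow_net_bigO.
by apply/funext => e; rewrite /pow_net powRr0 mulr1.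
Qed.

Lemma net1_bigON1 : ~ net_bigO 1 1.
Proof.
move=> /net_bigOP[k k0 H].
have K : \forall e \near eps_to0, val e < k^-1.
  by exists k^-1 => //=; rewrite invr_gt0.
have [e [+ +]] := filter_ex (filterI H K).
rewrite (_ : normc _ = 1) ?normc1// powRr1 ?(ltW (eps01_gt0 e))// => le1.
by rewrite -[k^-1]mul1r ltr_pdivlMr// mulrC ltNge le1.
Qed.

Definition moderate : {pred net} :=
  fun c => `[< exists N : nat, net_bigO c (- N%:R) >].

Lemma moderate_subring : subring_closed moderate.
Proof.
split=> [|c d /asboolP[N hN] /asboolP[M hM]|c d /asboolP[N hN] /asboolP[M hM]];
  apply/asboolP.
- by exists 0; rewrite oppr0; exact: net1_bigO.
- exists (maxn N M); apply: net_bigOD.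
    by apply: net_bigO_le hN; rewrite lerN2 ler_nat leq_maxl.
  by apply: net_bigON; apply: net_bigO_le hM; rewrite lerN2 ler_nat leq_maxr.
- by exists (N + M)%N; rewrite natrD opprD; exact: net_bigOM.
Qed.
HB.instance Definition _ := GRing.isSubringClosed.Build net moderate moderate_subring.

Record moderate_net := ModerateNet {
  moderate_val :> net;
  moderate_valP : moderate_val \in moderate }.
HB.instance Definition _ := [isSub for moderate_val].
HB.instance Definition _ := [Choice of moderate_net by <:].
HB.instance Definition _ := [SubChoice_isSubComNzRing of moderate_net by <:].

Definition negligible : {pred moderate_net} :=
  fun c => `[< forall q : nat, net_bigO (moderate_val c) q%:R >].

Lemma negligible_ideal : idealr_closed negligible.
Proof.
split; first by apply/asboolP => q; exact: net_bigO0.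
- by apply/asboolPn => /(_ 1%N); exact: net1_bigON1.
move=> a c d /asboolP hc /asboolP hd; apply/asboolP => q.
apply: net_bigOD => //=.
have [N hN] := asboolW (moderate_valP a).
have -> : q%:R = - N%:R + (q + N)%:R :> R by rewrite natrD; ring.
exact: net_bigOM.
Qed.
HB.instance Definition _ := isIdealr.Build moderate_net negligible negligible_ideal.

(* the ring E_M / N of generalized complex numbers *)
Definition gcomplex := {ideal_quot negligible}.
HB.instance Definition _ := GRing.ComNzRing.on gcomplex.
HB.instance Definition _ := EqQuotient.on gcomplex.
End nets.

Section generalized_numbers.
Variable R : realType.
Local Notation gC := (gcomplex R).

Definition gclass (c : moderate_net R) : gC := \pi_(gcomplex R)%qT c.

Lemma gclass_eqP (c d : moderate_net R) :
  gclass c = gclass d <-> forall q : nat, net_bigO (c - d : moderate_net R) q%:R.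
Proof.
split=> [/eqP|H].
  by rewrite /gclass -Quotient.idealrBE => /asboolP.
by apply/eqP; rewrite /gclass -Quotient.idealrBE; apply/asboolP.
Qed.

Lemma pow_net_moderate (z : R[i]) (a : R) : pow_net z a \in @moderate R.
Proof.
apply/asboolP; exists `|Num.floor a|%N.
apply: net_bigO_le (pow_net_bigO z a).
have := floor_le_tmp a; rewrite natr_absz intr_norm.
have := ler_norm (- (Num.floor a)%:~R : R); rewrite normrN; lra.
Qed.

(* the class [(z e^a)_e] *)
Definition gpow (z : R[i]) (a : R) : gC := gclass (ModerateNet (pow_net_moderate z a)).

Definition net_valuation (c : net R) : \bar R :=
  ereal_sup [set b%:E | b in [set b | net_bigO c b]].

Definition valuation (x : gC) : \bar R := net_valuation (repr x).

(* |x|_e = e^(- v(x)); v(x) = +oo is allowed, and then enorm x = 0, while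
   v(x) > -oo because representatives are moderate (see enormE). *)
Definition enorm (x : gC) : R := fine (expeR (- valuation x)%E).

Lemma valuation_class (c : moderate_net R) : valuation (gclass c) = net_valuation c.
Proof.
have H : gclass (repr (gclass c)) = gclass c by rewrite /gclass reprK.
have sub (x y : moderate_net R) b : gclass x = gclass y -> net_bigO x b -> net_bigO y b.
  move=> xy xb; have /gclass_eqP K := esym xy.
  have -> : (y : net R) = (y - x : moderate_net R) + (x : net R).
    by rewrite -[RHS]/(val (y - x + x)) subrK.
  apply: net_bigOD => //.
  apply: net_bigO_le (K `|Num.ceil b|%N).
  have := ceil_ge b; rewrite natr_absz intr_norm.
  have := ler_norm ((Num.ceil b)%:~R : R); lra.
congr ereal_sup; apply/seteqP; split => _ /= [b hb <-]; exists b => //.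
  exact: sub hb.
exact: sub hb.
Qed.

Lemma enormE (x : gC) : (enorm x)%:E = expeR (- valuation x)%E.
Proof.
rewrite /enorm fineK// ge0_fin_numE ?expeR_ge0// lt_neqAle leey andbT expeR_eqy.
have [N hN] := asboolW (moderate_valP (repr x)).
apply/negP => /eqP vy.
have : ((- N%:R)%:E <= valuation x)%E by apply: ereal_sup_ubound; exists (- N%:R).
by rewrite -[valuation x]oppeK vy.
Qed.

Lemma enorm_ge0 x : 0 <= enorm x.
Proof. by rewrite -lee_fin enormE expeR_ge0. Qed.

Lemma gpowN1 : gpow (-1) 0 = -1.
Proof.
have -> : (-1 : gC) = gclass (-1) by rewrite /gclass rmorphN rmorph1.
congr gclass; apply: val_inj; apply/funext => e /=.
by rewrite /pow_net powRr0 mulr1.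
Qed.
End generalized_numbers.

HB.mixin Record isUltraPseudoNormed (R : realType) M
    & GRing.Lmodule (gcomplex R) M := {
  upnorm : M -> R;
  upnorm_ge0 : forall u : M, 0 <= upnorm u;
  upnorm_eq0 : forall u : M, upnorm u = 0 <-> u = 0;
  upnormZ_le : forall (l : gcomplex R) (u : M), upnorm (l *: u) <= enorm l * upnorm u;
  upnorm_gpow : forall (z : R[i]) (a : R) (u : M), z != 0 ->
    upnorm (gpow z a *: u) = expR (- a) * upnorm u;
  upnormD_le : forall u v : M, upnorm (u + v) <= maxr (upnorm u) (upnorm v)
}.

#[short(type="upnModType")]
HB.structure Definition UltraPseudoNormedModule (R : realType) :=
  {M of GRing.Lmodule (gcomplex R) M & isUltraPseudoNormed R M}.

(* The metric structure is put on an alias of the carrier: the library declares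
   joins of topological spaces and modules over a numDomainType only, so that
   a type cannot carry both a topology and a gcomplex R-module structure. *)
Definition metric_of (R : realType) (G : upnModType R) : Type := G.

Section metric_of.
Variables (R : realType) (G : upnModType R).
Implicit Types u v w : G.

Lemma upnorm0 : upnorm (0 : G) = 0.
Proof. exact/upnorm_eq0. Qed.

Lemma upnormN u : upnorm (- u) = upnorm u.
Proof.
rewrite -scaleN1r -gpowN1 upnorm_gpow ?oppr_eq0 ?oner_eq0//.
by rewrite oppr0 expR0 mul1r.
Qed.

Let dist u v := upnorm (u - v).

Let distxx u : dist u u = 0.
Proof. by apply/upnorm_eq0; rewrite subrr. Qed.

Let dist_pos u v : dist u v = 0 -> u = v.
Proof. by move/upnorm_eq0/eqP; rewrite subr_eq0 => /eqP. Qed.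

Let dist_sym u v : dist u v = dist v u.
Proof. by rewrite /dist -(opprB v u) upnormN. Qed.

Let dist_triangle v u w : dist u w <= dist u v + dist v w.
Proof.
have -> : dist u w = upnorm ((u - v) + (v - w)) by rewrite addrA subrK.
rewrite (le_trans (upnormD_le _ _))//.
by rewrite ge_max lerDl lerDr !upnorm_ge0.
Qed.

HB.instance Definition _ := Choice.copy (metric_of G) G.
HB.instance Definition _ := isPointed.Build (metric_of G) (0 : G).
HB.instance Definition _ :=
  isMetric.Build R (metric_of G) distxx dist_pos dist_sym dist_triangle.

Lemma mdist_upnorm (u v : G) : mdist (u : metric_of G) v = upnorm (u - v).
Proof. by []. Qed.
End metric_of.

HB.mixin Record UltraPseudoNormed_isBanach (R : realType) M
    & UltraPseudoNormedModule R M := {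
  upn_cauchy_cvg : forall F : set_system (metric_of M),
    ProperFilter F -> cauchy F -> cvg F
}.

#[short(type="banachModType")]
HB.structure Definition BanachModule (R : realType) :=
  {M of UltraPseudoNormedModule R M & UltraPseudoNormed_isBanach R M}.

HB.instance Definition _ (R : realType) (G : banachModType R) :=
  Uniform_isComplete.Build (metric_of G) (@upn_cauchy_cvg R G).

Section continuous_linear.
Variables (R : realType) (G F : upnModType R).

Definition upn_continuous (f : G -> F) :=
  continuous (f : metric_of G -> metric_of F).

Lemma upn_continuousP (f : G -> F) : upn_continuous f <->
  forall u (e : R), 0 < e -> exists2 d : R, 0 < d &
    forall v, upnorm (u - v) < d -> upnorm (f u - f v) < e.
Proof.
split=> [cf u e e0|H u].
  have /nbhs_ballP[d /= d0 H] :
      \forall x \near (u : metric_of G), ball (f u : metric_of F) e (f x).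
    exact: (@cvg_ball _ (metric_of F) _ _ _ _ _ (cf u) _ e0).
  by exists d => // v; exact: H.
apply: (iffRL (@cvg_ballP _ (metric_of F) _ _
  (nbhs_filter (u : metric_of G)) _ (f u))) => e e0.
 have [d d0 {}H] := H u e e0.
apply/nbhs_ballP; exists d => //= v; exact: H.
Qed.

Definition clinear_pred : {pred G -> F} := fun f => `[< linear f /\ upn_continuous f >].

Lemma clinear_submod : submod_closed clinear_pred.
Proof.
split.
  apply/asboolP; split; first by move=> a u v /=; rewrite scaler0 addr0.
  apply/upn_continuousP => u e e0; exists 1; first exact: ltr01.
  by move=> v _; rewrite [X in upnorm X]subrr upnorm0.
move=> a f g /asboolP[lf /upn_continuousP cf] /asboolP[lg /upn_continuousP cg].
apply/asboolP; split.
  move=> k u v; rewrite -!/(_ *: _) /=.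
  rewrite -[LHS]/(a *: f (k *: u + v) + g (k *: u + v)).
  rewrite -[RHS]/(k *: (a *: f u + g u) + (a *: f v + g v)).
  rewrite lf lg !scalerDr !scalerA [a * k]mulrC -!addrA; congr (_ + _).
  by rewrite addrCA.
apply/upn_continuousP => u e e0.
have a0 : 0 < enorm a + 1 by rewrite ltr_wpDl// enorm_ge0.
have [d d0 H] := cf u _ (divr_gt0 e0 a0).
have [d' d'0 H'] := cg u e e0.
exists (minr d d'); first by rewrite lt_min d0.
move=> v; rewrite lt_min => /andP[/H uv /H' uv'].
rewrite -[X in upnorm X]/(a *: f u + g u - (a *: f v + g v)).
rewrite opprD addrACA -scalerBr (le_lt_trans (upnormD_le _ _))// gt_max uv' andbT.
rewrite (le_lt_trans (upnormZ_le _ _))//.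
move: uv; rewrite ltr_pdivlMr// mulrDr mulr1 mulrC; apply: le_lt_trans.
by rewrite lerDl upnorm_ge0.
Qed.
HB.instance Definition _ :=
  GRing.isSubmodClosed.Build (gcomplex R) (G -> F) clinear_pred clinear_submod.

Record clinear := CLinear {
  clinear_fun :> G -> F;
  clinear_funP : clinear_fun \in clinear_pred }.
HB.instance Definition _ := [isSub for clinear_fun].
HB.instance Definition _ := [Choice of clinear by <:].
HB.instance Definition _ := [SubChoice_isSubLmodule of clinear by <:].

Lemma clinear_linear (T : clinear) : linear T.
Proof. by case/asboolP: (clinear_funP T). Qed.

HB.instance Definition _ (T : clinear) :=
  GRing.isLinear.Build (gcomplex R) G F *:%R (clinear_fun T) (clinear_linear T).

Lemma clinear_continuous (T : clinear) : upn_continuous T.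
Proof. by case/asboolP: (clinear_funP T). Qed.

(* The supremum is over a set that is bounded above (op_norm_has_ubound); it is
   0 when that set is empty, i.e. when G = 0. *)
Definition op_norm (T : clinear) : R :=
  sup [set upnorm (T u) | u in [set u | upnorm u = 1]].

Lemma op_norm_has_ubound (T : clinear) :
  has_ubound [set upnorm (T u) | u in [set u | upnorm u = 1]].
Proof.
have /upn_continuousP /(_ 0 1 ltr01)[d d0 H] := @clinear_continuous T.
have d20 : 0 < d / 2 by rewrite divr_gt0.
exists (d / 2)^-1 => _ [u /= u1 <-].
have := H (gpow 1 (- ln (d / 2)) *: u).
rewrite linear0 (linearZ_LR T) !sub0r !upnormN !upnorm_gpow ?oner_eq0// opprK u1 mulr1.
rewrite !lnK ?posrE// ltr_pdivrMr// ltr_pMr// ltr1n => /(_ isT).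
by rewrite mulrC -ltr_pdivlMr// mul1r => /ltW.
Qed.

Lemma le_op_norm (T : clinear) u : upnorm u = 1 -> upnorm (T u) <= op_norm T.
Proof. by move=> u1; apply: (ub_le_sup (op_norm_has_ubound T)); exists u. Qed.

Lemma op_norm_le (T : clinear) c : 0 <= c ->
  (forall u, upnorm u = 1 -> upnorm (T u) <= c) -> op_norm T <= c.
Proof.
move=> c0 H; rewrite /op_norm; set A := (X in sup X).
have [->|A0] := eqVneq A set0; first by rewrite sup0.
by apply: ge_sup => [|_ [u u1 <-]]; [exact/set0P|exact: H].
Qed.

Let op_norm_ge0 T : 0 <= op_norm T.
Proof.
have [[u u1]|nu] := pselect (exists u : G, upnorm u = 1).
  exact: le_trans (upnorm_ge0 _) (le_op_norm T u1).
rewrite /op_norm (_ : mkset _ = set0) ?image_set0 ?sup0//.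
by apply/seteqP; split => // u u1; apply: nu; exists u.
Qed.

Let op_norm_eq0 T : op_norm T = 0 <-> T = 0.
Proof.
split=> [T0|->]; last first.
  apply/eqP; rewrite eq_le op_norm_ge0 andbT.
  by apply: op_norm_le => // u _; rewrite upnorm0.
apply: val_inj; apply/funext => u; rewrite -[LHS]/(T u) -[RHS]/(0 : F).
have [->|u0] := eqVneq u 0; first by rewrite linear0.
have Pu0 : 0 < upnorm u.
  by rewrite lt_neqAle upnorm_ge0 andbT eq_sym; apply: contra_neq u0 => /upnorm_eq0.
have := @le_op_norm T (gpow 1 (ln (upnorm u)) *: u).
rewrite (linearZ_LR T) !upnorm_gpow ?oner_eq0// expRN lnK ?posrE// mulVf ?gt_eqF//.
move=> /(_ erefl); rewrite T0 pmulr_rle0 ?invr_gt0// => Tu0.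
by apply/upnorm_eq0/eqP; rewrite eq_le Tu0 upnorm_ge0.
Qed.

Let op_normZ_le (l : gcomplex R) T : op_norm (l *: T) <= enorm l * op_norm T.
Proof.
apply: op_norm_le => [|u u1]; first by rewrite mulr_ge0 ?enorm_ge0.
rewrite (le_trans (upnormZ_le l (T u)))// ler_wpM2l ?enorm_ge0//.
exact: le_op_norm.
Qed.

Let op_norm_gpow (z : R[i]) (a : R) T : z != 0 ->
  op_norm (gpow z a *: T) = expR (- a) * op_norm T.
Proof.
move=> z0; apply/eqP; rewrite eq_le; apply/andP; split.
  apply: op_norm_le => [|u u1]; first by rewrite mulr_ge0 ?expR_ge0.
  rewrite [leLHS](upnorm_gpow z a (T u) z0) ler_pM2l ?expR_gt0//.
  exact: le_op_norm.
rewrite -ler_pdivlMl ?expR_gt0// -expRN opprK.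
apply: op_norm_le => [|u u1]; first by rewrite mulr_ge0 ?expR_ge0.
rewrite -[expR a]invrK -expRN ler_pdivlMl ?expR_gt0//.
by rewrite -(upnorm_gpow z a (T u) z0); exact: (le_op_norm (gpow z a *: T)).
Qed.

Let op_normD_le T U : op_norm (T + U) <= maxr (op_norm T) (op_norm U).
Proof.
apply: op_norm_le => [|u u1]; first by rewrite le_max op_norm_ge0.
rewrite (le_trans (upnormD_le (T u) (U u)))// ge_max !le_max.
by rewrite !le_op_norm// orbT.
Qed.

HB.instance Definition _ := isUltraPseudoNormed.Build R clinear
  op_norm_ge0 op_norm_eq0 op_normZ_le op_norm_gpow op_normD_le.

Lemma upnorm_clinearE (T : clinear) : upnorm T = op_norm T.
Proof. by []. Qed.
End continuous_linear.

(* Main.v *)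
Require Import Defs.
From mathcomp Require Import all_boot all_order all_algebra.
From mathcomp Require Import all_classical all_reals all_analysis.
From mathcomp Require Import complex.

Import Order.TTheory GRing.Theory Num.Theory.
Local Open Scope classical_set_scope.
Local Open Scope ereal_scope.

(** The proof is a gliding hump argument, in which the ultrametric inequality
    replaces the Baire category theorem.

    Let [q := e^(-1)].  If [Y] were not bounded in operator norm, there would be
    [T_n] in [Y] with [|T_n| > n / q^(n+1)], and vectors [z_n] of norm [q^n] at
    which [T_n] nearly attains its norm: [|T_n z_n| > q^(n+1) |T_n|]
    ([almost_norming_at_scale]).  Starting from [x_0 = 0], let [x_(n+1)] be
    either [x_n] or [x_n + z_n], whichever has the larger image under [T_n].
    Since [T_n z_n] is the difference of these two images, the ultrametric
    inequality gives [|T_n x_(n+1)| >= |T_n z_n| > q^(n+1) |T_n|]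
    ([hump_large]).

    The steps [z_n] tend to [0], so [x_n] has a limit [x] by completeness, and
    all steps after [x_(n+1)] have norm at most [q^(n+1)], hence so has their
    sum [x - x_(n+1)] ([upn_cvg_steps]).  Thus [T_n (x - x_(n+1))] is strictly
    smaller than [T_n x_(n+1)]; it cannot cancel it, so
    [|T_n x| > q^(n+1) |T_n| > n] for every [n], contradicting boundedness of
    [Y] at the point [x]. *)

Section ultra_pseudo_norm.
Set Implicit Arguments.
Unset Strict Implicit.
Local Open Scope ring_scope.
Variables (R : realType) (G : upnModType R).

Lemma upnormB_le (u v : G) : upnorm (u - v) <= Num.max (upnorm u) (upnorm v).
Proof. by rewrite -(upnormN v); exact: upnormD_le. Qed.

(** In an ultrametric, the total displacement of a walk is bounded by its
    largest step. *)
Lemma upnorm_walk_le (x : nat -> G) (r : nat -> R) (m n : nat) :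
  nonincreasing_seq r -> (forall k, upnorm (x k.+1 - x k) <= r k) ->
  (m <= n)%N -> upnorm (x n - x m) <= r m.
Proof.
move=> dr xr; elim: n => [|n IH].
  rewrite leqn0 => /eqP ->; rewrite subrr upnorm0.
  exact: le_trans (upnorm_ge0 _) (xr 0%N).
rewrite leq_eqVlt => /predU1P[->|]; last rewrite ltnS => mn.
  by rewrite subrr upnorm0; exact: le_trans (upnorm_ge0 _) (xr n.+1).
have -> : x n.+1 - x m = (x n.+1 - x n) + (x n - x m) by rewrite addrA subrK.
rewrite (le_trans (upnormD_le _ _))// ge_max IH// andbT.
by rewrite (le_trans (xr n))// dr.
Qed.
End ultra_pseudo_norm.

Section completeness.
Set Implicit Arguments.
Unset Strict Implicit.
Local Open Scope ring_scope.
Variables (R : realType) (G : banachModType R).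

(** The ultrametric inequality makes a sequence converge as soon as its steps
    tend to [0], and the distance from the limit is again bounded by the
    largest remaining step. *)
Lemma upn_cvg_steps (x : nat -> G) (r : nat -> R) :
  nonincreasing_seq r -> (forall n, 0 < r n) -> r n @[n --> \oo] --> 0 ->
  (forall k, upnorm (x k.+1 - x k) <= r k) ->
  exists l : G, forall n, upnorm (l - x n) <= r n.
Proof.
move=> dr r0 cr xr.
pose y : nat -> metric_of G := x.
have cy : cauchy (y @ \oo).
  apply: cauchy_exP => e e0.
  have [N _ rN] : \forall n \near \oo, r n < e by exact: (cvgr_lt 0).
  exists (y N); exists N => // n /= Nn.
  suff : upnorm (x N - x n) < e by [].
  by rewrite -upnormN opprB (le_lt_trans (upnorm_walk_le dr xr Nn))// rN /=.
have [l yl] := (cvg_ex _).1 (@upn_cauchy_cvg R G _ _ cy).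
exists l => n.
have [N _ HN] : \forall k \near \oo, ball l (r n) (y k).
  exact: (cvg_ball (y := l) yl).
have lN : upnorm ((l : G) - x (maxn N n)) < r n by apply: HN; exact: leq_maxl.
have -> : (l : G) - x n = (l - x (maxn N n)) + (x (maxn N n) - x n).
  by rewrite addrA subrK.
rewrite (le_trans (upnormD_le _ _))// ge_max (ltW lN)/=.
by rewrite upnorm_walk_le ?leq_maxr.
Qed.
End completeness.

Section clinear_norm.
Set Implicit Arguments.
Unset Strict Implicit.
Local Open Scope ring_scope.
Variables (R : realType) (G F : upnModType R).
Implicit Type T : clinear G F.

Lemma op_norm_ge0 T : 0 <= op_norm T.
Proof. exact: (@upnorm_ge0 R (clinear G F)). Qed.

Lemma upnorm_clinear_le T (u : G) : upnorm (T u) <= op_norm T * upnorm u.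
Proof.
have [->|u0] := eqVneq u 0; first by rewrite linear0 !upnorm0 mulr0.
have Pu0 : 0 < upnorm u.
  by rewrite lt_neqAle upnorm_ge0 andbT eq_sym; apply: contra_neq u0 => /upnorm_eq0.
have := @le_op_norm _ _ _ T (gpow 1 (ln (upnorm u)) *: u).
rewrite (linearZ_LR T) !upnorm_gpow ?oner_eq0// expRN lnK ?posrE// mulVf ?gt_eqF//.
by move=> /(_ erefl); rewrite mulrC ler_pdivrMr.
Qed.

(** Some unit vector almost attains the supremum defining the operator norm,
    and multiplication by the class [gpow 1 n] of the net [eps^n] scales all
    norms by exactly [expR (- n)]. *)
Lemma almost_norming_at_scale T (n : nat) : 0 < op_norm T ->
  exists2 z : G, upnorm z = expR (- 1) ^+ n &
    expR (- 1) ^+ n.+1 * op_norm T < upnorm (T z).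
Proof.
move=> T0.
have [u u1 Tu] : exists2 u : G, upnorm u = 1 &
    expR (- 1) * op_norm T < upnorm (T u).
  apply: contrapT => H.
  suff : op_norm T <= expR (- 1) * op_norm T.
    by rewrite leNgt gtr_pMl// expR_lt1 ltrN10.
  apply: op_norm_le => [|u u1]; first by rewrite mulr_ge0 ?expR_ge0 ?op_norm_ge0.
  by rewrite leNgt; apply/negP => Tu; apply: H; exists u.
have qn : expR (- n%:R) = expR (- 1) ^+ n :> R.
  by rewrite -expRM_natl mulrN1.
exists (gpow 1 n%:R *: u).
  by rewrite upnorm_gpow ?oner_eq0// u1 mulr1.
rewrite (linearZ_LR T) upnorm_gpow ?oner_eq0// qn exprSr -mulrA.
by rewrite ltr_pM2l// exprn_gt0// expR_gt0.
Qed.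

Fixpoint hump (T : nat -> clinear G F) (z : nat -> G) (n : nat) : G :=
  if n is m.+1 then
    let x := hump T z m in
    if upnorm (T m x) < upnorm (T m (z m)) then x + z m else x
  else 0.

Lemma hump_step (T : nat -> clinear G F) (z : nat -> G) n :
  upnorm (hump T z n.+1 - hump T z n) <= upnorm (z n).
Proof.
rewrite /=; case: ifPn => _; first by rewrite addrC addKr.
by rewrite subrr upnorm0 upnorm_ge0.
Qed.

(** [T_n (z_n)] is the difference of [T_n (x + z_n)] and [T_n x], so one of
    them is at least as large as it. *)
Lemma hump_large (T : nat -> clinear G F) (z : nat -> G) n :
  upnorm (T n (z n)) <= upnorm (T n (hump T z n.+1)).
Proof.
rewrite /=; case: ifPn => [h|]; last by rewrite -leNgt.
set x := hump T z n in h *.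
have := upnormB_le (T n (x + z n)) (T n x).
by rewrite -linearB [x + _]addrC addrK le_max [X in _ || X]leNgt h orbF.
Qed.
End clinear_norm.

Lemma unbounded_exists_gt (R : realType) (I : Type) (Y : set I) (f : I -> R) :
  ~ (ereal_sup [set (f i)%:E | i in Y] < +oo) ->
  forall M : R, exists2 i, Y i & (M < f i)%R.
Proof.
move=> nY M; apply: contrapT => H; apply: nY.
apply: (@le_lt_trans _ _ M%:E); last exact: ltry.
apply: ge_ereal_sup => _ [i Yi <-]; rewrite lee_fin leNgt.
by apply/negP => Mi; apply: H; exists i.
Qed.

Theorem theorem4p10 (R : realType) (G F : banachModType R)
    (Y : set (clinear G F)) :
  (forall u : G, ereal_sup [set (upnorm (T u))%:E | T in Y] < +oo) ->
  ereal_sup [set (upnorm T)%:E | T in Y] < +oo.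
Proof.
move=> ptY; apply: contrapT => /unbounded_exists_gt unY.
pose q : R := expR (- 1)%R.
have q0 : (0 < q)%R by exact: expR_gt0.
have q1 : (q < 1)%R by rewrite expR_lt1 ltrN10.
have qn0 n : (0 < q ^+ n)%R by rewrite exprn_gt0.
have /choice[T HT] (n : nat) : exists T : clinear G F,
    Y T /\ (n%:R < q ^+ n.+1 * op_norm T)%R.
  have [T YT nT] := unY (n%:R / q ^+ n.+1)%R.
  by exists T; split => //; rewrite mulrC -ltr_pdivrMr.
have T0 n : (0 < op_norm (T n))%R.
  have [_ nT] := HT n.
  by rewrite -(pmulr_rgt0 _ (qn0 n.+1)) (le_lt_trans _ nT).
have /choice[z Hz] (n : nat) : exists z : G, upnorm z = (q ^+ n)%R /\
    (q ^+ n.+1 * op_norm (T n) < upnorm (T n z))%R.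
  by have [z ? ?] := almost_norming_at_scale n (T0 n); exists z.
have [x Hx] : exists x : G, forall n, (upnorm (x - hump T z n) <= q ^+ n)%R.
  apply: upn_cvg_steps => //.
  - by apply/nonincreasing_seqP => n; rewrite exprS ger_pMl// ltW.
  - by apply: cvg_expr; rewrite gtr0_norm.
  - by move=> n; rewrite (le_trans (hump_step _ _ _))// (Hz n).1.
have Tx n : (n%:R < upnorm (T n x))%R.
  have [_ nT] := HT n; have [_ Tz] := Hz n.
  apply: (lt_trans nT); set y := hump T z n.+1.
  have Ty : (q ^+ n.+1 * op_norm (T n) < upnorm (T n y))%R.
    exact: lt_le_trans Tz (hump_large _ _ _).
  have Txy : (upnorm (T n (x - y)%R) <= q ^+ n.+1 * op_norm (T n))%R.
    by rewrite (le_trans (upnorm_clinear_le _ _))// mulrC ler_pM2r// Hx.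
  (* the ultrametric inequality for T y = T x - T (x - y) *)
  have := upnormB_le (T n x) (T n (x - y)%R).
  rewrite -linearB subKr le_max => /orP[|Tyxy].
    exact: lt_le_trans Ty.
  by have := lt_le_trans Ty (le_trans Tyxy Txy); rewrite ltxx.
have := ptY x; set s := ereal_sup _ => soo.
have Ts n : (n%:R)%:E < s.
  apply: (@lt_le_trans _ _ (upnorm (T n x))%:E); first by rewrite lte_fin.
  by apply: ereal_sup_ubound; exists (T n) => //; exact: (HT n).1.
have sfin : s \is a fin_num.
  by rewrite ge0_fin_numE// ltW// (Ts 0%N).
have := Ts (Num.truncn (fine s)).+1; rewrite -(fineK sfin) lte_fin ltNge.
by rewrite ltW// truncnS_gt.
Qed.
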